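(* (i) Let $n, r \in \mathbb{N}$ with $r \leq n$. Then $$a_{herm}(n;r) \leq 2 \left\lfloor \frac{r}{2} \right\rfloor \left(n - \left\lfloor \frac{r}{2} \right\rfloor\right).$$ (ii) Let $n, p, q \in \mathbb{N}$ with $p+q \leq n$. Then $$a_{herm}(n;p,q) \leq 2\min\{p,q\}\,\bigl(n - \min\{p,q\}\bigr).$$
   Context: $\mathbb{N}$ includes $0$. $H(n)$ denotes the $\mathbb{R}$-vector space of hermitian $n\times n$ complex matrices. A matrix in $H(n)$ has signature $(p,q)$ if it has exactly $p$ positive and exactly $q$ negative eigenvalues, counted with multiplicity. An affine subspace $S$ of $H(n)$ is a set of the form $M+L$ with $M \in H(n)$ and $L$ an $\mathbb{R}$-linear subspace of $H(n)$; its dimension is the real dimension $\dim_{\mathbb{R}} L$. $S$ has constant rank $r$ if every matrix of $S$ has rank $r$. $a_{herm}(n;r)$ denotes the maximum of $\dim S$ over all affine subspaces $S$ of $H(n)$ of constant rank $r$. $a_{herm}(n;p,q)$ denotes the maximum of $\dim S$ over all affine subspaces $S$ of $H(n)$ such that every $A \in S$ has signature $(p,q)$. *)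

(* Defs.v *)
From HB Require Import structures.
From mathcomp Require Import all_boot all_order all_algebra.
From mathcomp Require Import complex.
From mathcomp Require Import boolp classical_sets reals.

Set Implicit Arguments.
Unset Strict Implicit.
Unset Printing Implicit Defensive.

Import Order.TTheory GRing.Theory Num.Theory.

Local Open Scope ring_scope.
Local Open Scope complex_scope.
Local Open Scope classical_set_scope.

Record hermmx (R : realType) (n : nat) : Type := HermMx {
  hermmx_val :> 'M[R[i]]_n;
  _ : hermmx_val \is hermsymmx }.

Section HermitianVectType.
Variables (R : realType) (n : nat).
Local Notation H := (hermmx R n).
Implicit Types (A B : H) (a b : R) (i j : 'I_n).

HB.instance Definition _ := [isSub of H for @hermmx_val R n].
HB.instance Definition _ := [Choice of H by <:].

Lemma hermmxP (M : 'M[R[i]]_n) :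
  reflect (forall i j, M i j = (M j i)^*) (M \is hermsymmx).
Proof.
apply: (iffP idP) => [/is_hermitianmxP MH i j|MH].
  by rewrite {1}MH expr0 scale1r !mxE.
by apply/is_hermitianmxP/matrixP => i j; rewrite expr0 scale1r !mxE MH.
Qed.

Lemma hermmxE A i j : A i j = (A j i)^*.
Proof. by case: A => M MH /=; exact/hermmxP. Qed.

Fact hermmx_zmod_closed :
  zmod_closed (fun M : 'M[R[i]]_n => M \is hermsymmx).
Proof.
split=> [|M N]; rewrite !unfold_in.
  by apply/hermmxP => i j; rewrite !mxE rmorph0.
move=> /hermmxP MH /hermmxP NH; apply/hermmxP => i j.
by rewrite !mxE rmorphB /= -MH -NH.
Qed.

HB.instance Definition _ :=
  GRing.SubChoice_isSubZmodule.Build _ _ H hermmx_zmod_closed.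

Fact hermmx_scale_subproof a A : a%:C *: (A : 'M_n) \is hermsymmx.
Proof.
apply/hermmxP => i j; rewrite !mxE rmorphM /= -hermmxE.
by rewrite oppr0.
Qed.

Definition hermmx_scale a A : H := HermMx (hermmx_scale_subproof a A).

Fact hermmx_scaleA a b A :
  hermmx_scale a (hermmx_scale b A) = hermmx_scale (a * b) A.
Proof. by apply/val_inj; rewrite /= scalerA rmorphM. Qed.
Fact hermmx_scale1 : left_id 1 hermmx_scale.
Proof. by move=> A; apply/val_inj; rewrite /= scale1r. Qed.
Fact hermmx_scaleDr : right_distributive hermmx_scale +%R.
Proof. by move=> a A B; apply/val_inj; rewrite /= scalerDr. Qed.
Fact hermmx_scaleDl A : {morph hermmx_scale^~ A : a b / a + b}.
Proof. by move=> a b; apply/val_inj; rewrite /= rmorphD scalerDl. Qed.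

HB.instance Definition _ := GRing.Zmodule_isLmodule.Build R H
  hermmx_scaleA hermmx_scale1 hermmx_scaleDr hermmx_scaleDl.

(* Real coordinates: the real parts of the entries on and above the diagonal, *)
(* and the imaginary parts of the entries strictly above it, stored below.    *)
Definition hermmx_coord A : 'M[R]_n :=
  \matrix_(i, j) if (i <= j)%N then complex.Re (A i j) else complex.Im (A j i).

Definition hermmx_of_coord_mx (X : 'M[R]_n) : 'M[R[i]]_n :=
  \matrix_(i, j) if (i < j)%N then X i j +i* X j i
                 else if (j < i)%N then X j i -i* X i j else (X i i)%:C.

Fact hermmx_of_coord_subproof X : hermmx_of_coord_mx X \is hermsymmx.
Proof.
apply/hermmxP => i j; rewrite !mxE.
case: (ltngtP i j) => [_|_|/val_inj ->] /=; rewrite ?opprK //.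
by rewrite oppr0.
Qed.

Definition hermmx_of_coord X : H := HermMx (hermmx_of_coord_subproof X).

Lemma hermmx_coordK : cancel hermmx_coord hermmx_of_coord.
Proof.
move=> A; apply/val_inj/matrixP => i j; rewrite !mxE /=.
case: (ltngtP i j) => [ij|ij|/val_inj ->].
- by rewrite ?(leqNgt j i) ?ij /=; case: (A i j).
- by rewrite ?(leqNgt i j) ?ij /= (hermmxE A i j); case: (A j i).
- rewrite leqnn; move: (hermmxE A j j).
  by case: (A j j) => x y [] /eqP; rewrite -addr_eq0 -mulr2n mulrn_eq0 => /eqP ->.
Qed.

Lemma hermmx_of_coordK : cancel hermmx_of_coord hermmx_coord.
Proof.
move=> X; apply/matrixP => i j; rewrite !mxE.
by case: (ltngtP i j) => [|ij|/val_inj ->] //=; rewrite ltnn.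
Qed.

Fact hermmx_vect_axiom : Vector.axiom (n * n) H.
Proof.
exists (fun A => mxvec (hermmx_coord A)).
  move=> a A B; rewrite -linearP; congr mxvec; apply/matrixP => i j.
  rewrite !mxE /=; case: ifP => _;
    case: (hermmx_val A _ _) => ? ?; case: (hermmx_val B _ _) => ? ? /=.
    by rewrite mul0r subr0.
  by rewrite mul0r addr0.
exists (fun v => hermmx_of_coord (vec_mx v)) => [A|v].
  by rewrite mxvecK hermmx_coordK.
by rewrite hermmx_of_coordK vec_mxK.
Qed.

HB.instance Definition _ := Lmodule_hasFinDim.Build R H hermmx_vect_axiom.

End HermitianVectType.

Section AffineSubspaces.
Variables (K : fieldType) (V : vectType K).
Implicit Types (M : V) (L : {vspace V}) (P : set V -> Prop).

Definition affine_subspace M L : set V := [set M + B | B in [set B | B \in L]].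

Definition affine_of_dim (S : set V) (d : nat) : Prop :=
  exists M L, S = affine_subspace M L /\ \dim L = d.

(* No dimension exceeds dim V, so the range loses nothing; the value is 0 if  *)
(* no affine subspace satisfies P.                                            *)
Definition max_affine_dim P : nat :=
  \max_(d < (\dim {:V}).+1 | `[< exists2 S, affine_of_dim S d & P S >]) d.

Lemma max_affine_dim_ub P S d :
  affine_of_dim S d -> P S -> (d <= max_affine_dim P)%N.
Proof.
move=> Sd PS; have ltd : (d < (\dim {:V}).+1)%N.
  by case: Sd => M [L [_ <-]]; rewrite ltnS dimvS ?subvf.
apply: (@leq_bigmax_cond _ _ (fun i : 'I_(\dim {:V}).+1 => val i) (Ordinal ltd)).
by apply/asboolP; exists S.
Qed.

Lemma max_affine_dim_attained P S d : affine_of_dim S d -> P S ->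
  exists2 S', affine_of_dim S' (max_affine_dim P) & P S'.
Proof.
move=> Sd PS; have ltd : (d < (\dim {:V}).+1)%N.
  by case: Sd => M [L [_ <-]]; rewrite ltnS dimvS ?subvf.
have Pd : `[< exists2 S, affine_of_dim S (Ordinal ltd) & P S >].
  by apply/asboolP; exists S.
rewrite /max_affine_dim (bigop.bigmax_eq_arg _ Pd).
by case: arg_maxnP => // i /asboolP.
Qed.

End AffineSubspaces.

Section Herm.
Variables (R : realType) (n : nat).
Implicit Types S : set (hermmx R n).

Definition eigenvalues (A : 'M[R[i]]_n) : seq R[i] :=
  sval (closed_field_poly_normal (char_poly A)).

Lemma eigenvaluesE (A : 'M[R[i]]_n) :
  char_poly A = \prod_(z <- eigenvalues A) ('X - z%:P).
Proof.
rewrite /eigenvalues; case: closed_field_poly_normal => s /= {1}->.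
by rewrite (monicP (char_poly_monic A)) scale1r.
Qed.

(* In the order of R[i], [0 < z] means that z is real and positive. *)
Definition has_signature (A : 'M[R[i]]_n) (p q : nat) : Prop :=
  count (fun z => 0 < z) (eigenvalues A) = p /\
  count (fun z => z < 0) (eigenvalues A) = q.

Definition constant_rank (r : nat) S : Prop := forall A, S A -> \rank A = r.

Definition constant_signature (p q : nat) S : Prop :=
  forall A, S A -> has_signature A p q.

End Herm.

Definition a_herm_rank (R : realType) (n r : nat) : nat :=
  max_affine_dim (@constant_rank R n r).

Definition a_herm_signature (R : realType) (n p q : nat) : nat :=
  max_affine_dim (@constant_signature R n p q).

(* Main.v *)
From HB Require Import structures.
Require Import Defs.
From mathcomp Require Import all_boot all_order all_algebra.
From mathcomp Require Import reals.
From mathcomp Require Import complex boolp classical_sets zify.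

(** Both bounds come from one estimate: if every matrix of the affine space
    M + L has the same rank r, and M has p positive and q negative eigenvalues,
    then dim L is at most 2p(n - p), and also at most 2q(n - q).

    By Sylvester's law of inertia ([hermitian_inertia]), after a congruence M
    becomes a diagonal matrix N with entries 1, -1 and 0.  Split the indices
    into the p indices I where N has the entry 1 and the n - p others.  A
    hermitian matrix is determined by its two diagonal blocks and by its
    rectangular I x ~I block, and the latter has p(n - p) complex entries, that
    is 2p(n - p) real coordinates.  So it suffices that the rectangular block
    determines an element of L, i.e. that B = 0 whenever B in L is block
    diagonal for this splitting ([rect_block_dim]).

    That is [constant_rank_line_eq0].  Put E = N^2, the projector on the
    support of N, and F = 1 - E.  As N + tB has rank r = rank E for all real t,
    the Schur complement of its E-block vanishes ([schur_complement_rank]):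
    FBF = t FBE K(t)^-1 EBF, where K(t) is the E-block of N + tB extended by the
    identity.  Multiplied by det K(t), this is an identity of polynomials in t;
    the coefficients at t = 0 and then at first order give FBF = 0 and
    FBNBF = 0 ([kernel_block_eq0]).  If B is block diagonal, FB kills the
    positive part of N, so N acts as -1 behind FB and FBNBF is minus a Gram
    matrix: hence FB = 0.  Now B lives on the support of N and commutes with N,
    so NB is hermitian; a nonzero eigenvalue e of NB would make the rank of
    N - B/e drop.  Hence NB = 0 and B = 0.

    The bound by q is the bound by p for -M.  A constant signature (p, q)
    forces the constant rank p + q, which gives the second part; for the first
    part, min(p, q) <= r/2 <= n/2 where p + q = r, and x(n - x) is increasing
    for x <= n/2. *)

Set Implicit Arguments.
Unset Strict Implicit.
Unset Printing Implicit Defensive.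

Import Order.TTheory GRing.Theory Num.Theory.

Local Open Scope ring_scope.
Local Open Scope sesquilinear_scope.

(** * Rank and characteristic polynomial *)

Section RankCharPoly.
Variable F : fieldType.

(** With A the 0/1 matrix of the inclusion of the support of d, the matrix
    diag d factors as A D A^T, where D = A^T (diag d) A is diagonal with
    nonzero entries, of size the cardinal of the support. *)
Lemma mxrank_diag n (d : 'rV[F]_n) :
  \rank (diag_mx d) = #|[set i | d 0 i != 0]|.
Proof.
set I := [set i | _].
pose A : 'M[F]_(n, #|I|) := \matrix_(i, k) (i == enum_val k)%:R.
pose d' : 'rV[F]_#|I| := \row_k d 0 (enum_val k).
have AA : A^T *m diag_mx d *m A = diag_mx d'.
  apply/matrixP => k l; rewrite mul_mx_diag !mxE (bigD1 (enum_val k)) //=.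
  rewrite big1 => [|i ik]; last by rewrite !mxE (negPf ik) !mul0r.
  by rewrite !mxE eqxx mul1r addr0 (inj_eq enum_val_inj) mulr_natr.
have dA : diag_mx d = A *m (diag_mx d' *m A^T).
  apply/matrixP => i j; rewrite mul_diag_mx !mxE.
  have [iI|iI] := boolP (i \in I); last first.
    rewrite inE negbK in iI; rewrite (eqP iI) mul0rn big1 // => k _.
    rewrite !mxE; case: eqP => [ik|_]; last by rewrite mul0r.
    by rewrite -ik (eqP iI) !mul0r mulr0.
  rewrite (bigD1 (enum_rank_in iI i)) //= !mxE enum_rankK_in // eqxx mul1r.
  rewrite big1 ?addr0 => [|k ki]; first by rewrite mulr_natr eq_sym.
  rewrite !mxE; case: eqP => [ik|_]; last by rewrite mul0r.
  by case/eqP: ki; apply: enum_val_inj; rewrite enum_rankK_in.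
have d'u : diag_mx d' \in unitmx.
  rewrite unitmxE det_diag unitfE; apply/prodf_neq0 => k _.
  by rewrite mxE; have := enum_valP k; rewrite inE.
apply/eqP; rewrite eqn_leq; apply/andP; split.
  by rewrite dA (leq_trans (mxrankM_maxl _ _)) // rank_leq_col.
rewrite -[X in (X <= _)%N](mxrank_unit d'u) -AA.
by rewrite (leq_trans (mxrankM_maxl _ _)) // mxrankM_maxr.
Qed.

Lemma mxrank_mul_unit m n (A : 'M[F]_m) (B : 'M[F]_(m, n)) (C : 'M[F]_n) :
  A \in unitmx -> C \in unitmx -> \rank (A *m B *m C) = \rank B.
Proof.
move=> Au Cu; rewrite mxrankMfree ?row_free_unit // -mxrank_tr trmx_mul.
by rewrite mxrankMfree ?row_free_unit ?unitmx_tr // mxrank_tr.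
Qed.

Lemma char_poly_conj n (P A : 'M[F]_n) :
  P \in unitmx -> char_poly (invmx P *m A *m P) = char_poly A.
Proof.
move=> Pu; pose c := map_mx (@polyC F).
have cV : c n n (invmx P) *m c n n P = 1%:M.
  by rewrite -map_mxM mulVmx // map_mx1.
have -> : char_poly (invmx P *m A *m P) =
    \det (c _ _ (invmx P) *m char_poly_mx A *m c _ _ P).
  congr (\det _); rewrite /char_poly_mx mulmxBr mulmxBl -!map_mxM.
  by congr (_ - _); rewrite scalar_mxC -mulmxA cV mulmx1.
by rewrite !det_mulmx mulrAC -det_mulmx cV det1 mul1r.
Qed.

Lemma adj_involution n (A : 'M[F]_n) : A *m A = 1%:M -> \adj A = \det A *: A.
Proof.
by move=> AA; rewrite -[LHS]mulmx1 -AA mulmxA mul_adj_mx mul_scalar_mx.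
Qed.

End RankCharPoly.

(** * Hermitian matrices and Sylvester's law of inertia *)

Section Hermitian.
Variable C : numClosedFieldType.

Lemma hermP n (A : 'M[C]_n) : reflect (A^t* = A) (A \is hermsymmx).
Proof.
by apply: (iffP (is_hermitianmxP _ _ _)); rewrite expr0 scale1r; move/esym.
Qed.

Lemma trmxC_mul m n p (A : 'M[C]_(m, n)) (B : 'M[C]_(n, p)) :
  (A *m B)^t* = B^t* *m A^t*.
Proof. by rewrite trmx_mul map_mxM. Qed.

Lemma hermitian_congruence n (P A : 'M[C]_n) :
  A \is hermsymmx -> P^t* *m A *m P \is hermsymmx.
Proof.
by move/hermP=> Ah; apply/hermP; rewrite !trmxC_mul Ah trmxCK mulmxA.
Qed.

Lemma mulmx_trmxC_eq0 m n (A : 'M[C]_(m, n)) : A *m A^t* = 0 -> A = 0.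
Proof.
move=> A0; apply/matrixP => i j; have /matrixP/(_ i i) := A0.
rewrite !mxE => sum0.
have {}sum0 : \sum_k `|A i k| ^+ 2 = 0.
  by rewrite -[RHS]sum0; apply: eq_bigr => k _; rewrite !mxE normCK.
have /(_ j isT)/eqP :=
  psumr_eq0P (fun k _ => exprn_ge0 2 (normr_ge0 (A i k))) sum0.
by rewrite expf_eq0 /= normr_eq0 => /eqP.
Qed.

Lemma spectral_diag_real n (A : 'M[C]_n) i :
  A \is hermsymmx -> spectral_diag A 0 i \is Num.real.
Proof. by move=> /hermitian_spectral_diag_real/mxOverP; apply. Qed.

Lemma hermitian_eq0 n (A : 'M[C]_n) : A \is hermsymmx ->
  (forall e (v : 'rV_n),
     v *m A = e *: v -> e \is Num.real -> e != 0 -> v = 0) ->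
  A = 0.
Proof.
move=> Ah H; have /orthomx_spectralP AE := hermitian_normalmx Ah.
set P := spectralmx A in AE; set d := spectral_diag A in AE.
have Pu : P \in unitmx by rewrite spectral_unit.
suff d0 : d = 0 by rewrite AE d0 (raddf0 (@diag_mx C n)) mulmx0 mul0mx.
apply/rowP => i; rewrite mxE; apply/eqP/contraT => di.
have PA : P *m A = diag_mx d *m P by rewrite AE !mulmxA mulmxV // mul1mx.
have Pi : row i P = 0.
  apply: (H (d 0 i)) => //; last exact: spectral_diag_real.
  by rewrite -row_mul PA row_mul row_diag_mx -scalemxAl -rowE.
have := congr1 (mulmxr (invmx P)) Pi.
rewrite /= -row_mul mulmxV // mul0mx => /rowP/(_ i)/eqP.
by rewrite !mxE eqxx oner_eq0.
Qed.

(** The spectral theorem, with the rows of the unitary matrix rescaled by the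
    square roots of the absolute values of the nonzero eigenvalues. *)
Lemma hermitian_inertia n (A : 'M[C]_n) : A \is hermsymmx ->
  {P | P \in unitmx &
    A = P^t* *m diag_mx (map_mx Num.sg (spectral_diag A)) *m P}.
Proof.
move=> Ah; have /orthomx_spectralP AE := hermitian_normalmx Ah.
have dR i := spectral_diag_real i Ah.
set U := spectralmx A in AE; set d := spectral_diag A in AE dR *.
pose c : 'rV[C]_n := \row_i (if d 0 i == 0 then 1 else sqrtC `|d 0 i|).
have cR i : (c 0 i)^* = c 0 i.
  rewrite mxE; case: ifP => _; first exact: conjC1.
  by apply: CrealP; rewrite ger0_real // sqrtC_ge0.
exists (diag_mx c *m U).
  rewrite unitmx_mul spectral_unit andbT unitmxE det_diag unitfE.
  apply/prodf_neq0 => i _; rewrite mxE; case: ifP => [_|/negbT di].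
    exact: oner_neq0.
  by rewrite sqrtC_eq0 normr_eq0.
rewrite {1}AE trmxC_mul -invmx_unitary ?spectral_unitarymx //.
have -> : (diag_mx c)^t* = diag_mx c.
  rewrite tr_diag_mx map_diag_mx; congr diag_mx.
  by apply/rowP => i; rewrite [LHS]mxE; exact: cR.
rewrite -!mulmxA; congr (_ *m _); rewrite !mulmxA; congr (_ *m _).
rewrite !mulmx_diag; congr diag_mx; apply/rowP => i; rewrite !mxE.
have [->|di] := eqVneq (d 0 i) 0; first by rewrite sgr0 mulr0 mul0r.
by rewrite mulrAC -expr2 sqrtCK mulrC; exact: realEsg.
Qed.

Lemma rank_inertia n (A : 'M[C]_n) : A \is hermsymmx ->
  \rank A = (#|[set i | (0 < spectral_diag A 0 i)%R]|
             + #|[set i | (spectral_diag A 0 i < 0)%R]|)%N.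
Proof.
move=> Ah; have /orthomx_spectralP AE := hermitian_normalmx Ah.
rewrite {1}AE mxrank_mul_unit ?unitmx_inv ?spectral_unit // mxrank_diag.
rewrite -cardsUI [X in (_ + X)%N]eq_card0 ?addn0 => [|i]; last first.
  by rewrite !inE; apply/negP => /andP[/lt_trans h /h]; rewrite ltxx.
apply: eq_card => i; rewrite !inE.
by rewrite real_neqr_lt ?real0 ?spectral_diag_real // orbC.
Qed.

End Hermitian.

(** * Lines of matrices of constant rank *)

Section ConstantRankLines.
Variable C : numClosedFieldType.

Lemma poly_nat_roots_eq0 (p : {poly C}) :
  (forall k : nat, p.[k%:R] = 0) -> p = 0.
Proof.
move=> p0.
apply: (@roots_geq_poly_eq0 _ _ [seq k%:R | k <- iota 0 (size p)]).
- by apply/allP => _ /mapP[k _ ->]; apply/eqP.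
- by rewrite map_inj_uniq ?iota_uniq // => i j /eqP; rewrite eqr_nat => /eqP.
- by rewrite size_map size_iota.
Qed.

Section PartialInvolution.
Variables (n : nat) (N E F : 'M[C]_n).
Hypotheses (NN : N *m N = E) (EN : E *m N = N) (F_def : F = 1%:M - E).

Let NE : N *m E = N. Proof. by rewrite -NN mulmxA NN. Qed.
Let EE : E *m E = E. Proof. by rewrite -{2}NN mulmxA EN. Qed.
Let EF : E *m F = 0. Proof. by rewrite F_def mulmxBr mulmx1 EE subrr. Qed.
Let FE : F *m E = 0. Proof. by rewrite F_def mulmxBl mul1mx EE subrr. Qed.
Let NF : N *m F = 0. Proof. by rewrite F_def mulmxBr mulmx1 NE subrr. Qed.
Let FN : F *m N = 0. Proof. by rewrite F_def mulmxBl mul1mx EN subrr. Qed.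
Let FF : F *m F = F. Proof. by rewrite {1}F_def mulmxBl mul1mx EF subr0. Qed.

Let NF2 : (N + F) *m (N + F) = 1%:M.
Proof.
by rewrite mulmxDl !mulmxDr NF FN FF addr0 add0r NN F_def addrC subrK.
Qed.

(** The E-rows of W already have rank at least that of E, because the E-block
    of W is that of the invertible K.  As W has no larger rank, its F-rows
    are combinations T E W of its E-rows; comparing E-columns determines the
    coefficients FTE, and comparing F-columns gives the identity.  The adjugate
    is used instead of the inverse so that both sides are polynomial in t. *)
Lemma schur_complement_rank (B W K : 'M[C]_n) (t : C) :
  K = N + F + t *: (E *m B *m E) ->
  W = N + t *: B -> \rank W = \rank N -> t != 0 -> \det K != 0 ->
  \det K *: (F *m B *m F)
    = t *: ((F *m B *m E) *m \adj K *m (E *m B *m F)).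
Proof.
move=> KD WD rkW t0 detK.
have Ku : K \in unitmx by rewrite unitmxE unitfE.
have EWE : E *m W *m E = E *m K.
  rewrite WD KD !mulmxDr EF addr0 mulmxDl EN NE.
  by rewrite -!scalemxAr -scalemxAl !mulmxA EE.
have EK : E *m K = K *m E.
  rewrite -EWE KD !mulmxDl FE addr0 WD mulmxDr mulmxDl EN.
  by rewrite -!scalemxAr -!scalemxAl -!mulmxA EE.
have EWEK : E *m W *m E *m invmx K = E by rewrite EWE mulmxK.
have rkEW : \rank (E *m W) = \rank W.
  apply/eqP; rewrite eqn_leq mxrankM_maxr rkW /=.
  rewrite -{1}EN (leq_trans (mxrankM_maxl _ _)) // -{1}EWEK -mulmxA.
  exact: mxrankM_maxl.
have /submxP[T WE] : (W <= E *m W)%MS.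
  have := mxrank_leqif_sup (submxMl E W).
  by move=> /leqifP; rewrite rkEW ltnn; case: ifP.
have FTE : F *m T *m E *m K = t *: (F *m B *m E).
  rewrite -(mulmxA _ E) -EWE mulmxA mulmxA -[F *m T *m E *m W]mulmxA.
  rewrite -(mulmxA F T) -WE WD mulmxDr FN add0r.
  by rewrite -scalemxAr -scalemxAl.
have EWF : E *m W *m F = t *: (E *m B *m F).
  by rewrite WD mulmxDr EN mulmxDl NF add0r -scalemxAr -scalemxAl.
have FWF : F *m W *m F = t *: (F *m B *m F).
  by rewrite WD mulmxDr FN add0r -scalemxAr -scalemxAl.
have FTEWF : F *m W *m F = F *m T *m E *m (E *m W *m F).
  by rewrite {1}WE -!mulmxA (mulmxA E E) EE.
have FTEK : \det K *: (F *m T *m E) = t *: (F *m B *m E *m \adj K).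
  by rewrite -mul_mx_scalar -mul_mx_adj mulmxA FTE -scalemxAl.
apply: (scalerI t0); transitivity (\det K *: (t *: (F *m B *m F))).
  by rewrite !scalerA mulrC.
rewrite -FWF FTEWF EWF [LHS]scalemxAl FTEK -scalemxAl -scalemxAr.
by congr (t *: _).
Qed.

(** The Schur complement identity holds at every natural number t that is not
    one of the finitely many roots of t det K(t), hence as an identity P = 0 of
    polynomial matrices.  At t = 0 it reads det(N + F) FBF = 0; once FBF = 0,
    dividing it by t and taking t = 0 again gives FBE (N + F)^-1 EBF = 0, where
    N + F is its own inverse. *)
Lemma kernel_block_eq0 (B : 'M[C]_n) :
  (forall k : nat, \rank (N + k%:R *: B)%R = \rank N) ->
  F *m B *m F = 0 /\ F *m B *m N *m B *m F = 0.
Proof.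
move=> rkN.
have NF_unit : \det (N + F) != 0.
  apply: contraTneq (oner_neq0 C) => d0.
  by rewrite negbK -(@det1 C n) -NF2 det_mulmx d0 mul0r.
pose c := map_mx (@polyC C).
pose K : 'M[{poly C}]_n := c _ _ (N + F) + 'X *: c _ _ (E *m B *m E).
pose Q := c _ _ (F *m B *m E) *m \adj K *m c _ _ (E *m B *m F).
pose P : 'M[{poly C}]_n := \det K *: c _ _ (F *m B *m F) - 'X *: Q.
have evc t m p (A : 'M_(m, p)) : map_mx (horner_eval t) (c _ _ A) = A.
  by apply/matrixP => i j; rewrite !mxE /horner_eval hornerC.
have evK t : map_mx (horner_eval t) K = N + F + t *: (E *m B *m E).
  by rewrite map_mxD map_mxZ !evc /= /horner_eval hornerX.
have evQ t : map_mx (horner_eval t) Q =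
    F *m B *m E *m \adj (N + F + t *: (E *m B *m E)) *m (E *m B *m F).
  by rewrite !map_mxM map_mx_adj !evc evK.
have evP t : map_mx (horner_eval t) P =
    \det (N + F + t *: (E *m B *m E)) *: (F *m B *m F)
    - t *: map_mx (horner_eval t) Q.
  by rewrite map_mxB !map_mxZ evc -det_map_mx evK /= /horner_eval hornerX.
have K0 : \det K != 0.
  apply: contraNneq NF_unit => K0.
  have := evK 0; rewrite scale0r addr0 => <-.
  by rewrite det_map_mx K0 rmorph0.
have P0 : P = 0.
  apply/matrixP => i j; rewrite [RHS]mxE; apply/eqP.
  suff /eqP : P i j * 'X * \det K = 0.
    by rewrite !mulf_eq0 (negPf K0) polyX_eq0 !orbF.
  apply: poly_nat_roots_eq0 => k; rewrite !hornerM hornerX.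
  have [->|k0] := eqVneq (k%:R : C) 0; first by rewrite mulr0 mul0r.
  have [->|Kk0] := eqVneq (\det K).[k%:R] 0; first by rewrite mulr0.
  have /matrixP/(_ i j) := evP k%:R; rewrite evQ.
  rewrite (schur_complement_rank (erefl _) (erefl _)) ?rkN //.
    by rewrite subrr !mxE /horner_eval => ->; rewrite !mul0r.
  by rewrite -evK det_map_mx.
have FBF : F *m B *m F = 0.
  have /eqP := evP 0; rewrite P0 raddf0 !scale0r subr0 addr0 eq_sym.
  by rewrite scaler_eq0 (negPf NF_unit) => /eqP.
split=> //.
have Q0 : Q = 0.
  apply/matrixP => i j; rewrite [RHS]mxE; apply/eqP.
  have /matrixP/(_ i j) := P0; rewrite /P FBF [c _ _ 0]raddf0 scaler0 sub0r.
  by rewrite !mxE => /eqP; rewrite oppr_eq0 mulf_eq0 polyX_eq0.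
have := evQ 0; rewrite Q0 raddf0 scale0r addr0 adj_involution //.
rewrite -scalemxAr -scalemxAl => /esym/eqP.
rewrite scaler_eq0 (negPf NF_unit) => /eqP <-.
rewrite mulmxDr mulmxDl -!mulmxA (mulmxA F E) FE mul0mx !mulmx0 addr0.
by rewrite (mulmxA N E) NE (mulmxA E N) EN.
Qed.

End PartialInvolution.

(** N^2 + N is twice the projector on the eigenspace of N for the eigenvalue 1,
    so commuting with it means being block diagonal for the splitting into this
    eigenspace and its orthogonal complement, which mixes -1 and 0. *)
Lemma constant_rank_line_eq0 n (N B : 'M[C]_n) :
  N \is hermsymmx -> B \is hermsymmx -> N *m N *m N = N ->
  (N *m N + N) *m B = B *m (N *m N + N) ->
  (forall t, t \is Num.real -> \rank (N + t *: B)%R = \rank N) -> B = 0.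
Proof.
move=> /hermP Nh /hermP Bh N3 NB rkN.
pose E := N *m N; pose F := 1%:M - E.
have [FBF FBNBF] :=
  kernel_block_eq0 (erefl E) N3 (erefl F) (fun k => rkN _ (realn _ k)).
have FN : F *m N = 0 by rewrite mulmxBl mul1mx N3 subrr.
have Eh : E^t* = E by rewrite trmxC_mul Nh.
have Fh : F^t* = F by rewrite linearB /= map_mxB trmx1 map_mx1 Eh.
have FBN0 : F *m B *m N = 0.
  have FBE : F *m B *m E = - (F *m B *m N).
    apply/eqP; rewrite -addr_eq0 -mulmxDr -mulmxA -NB mulmxA mulmxDr FN.
    by rewrite mulmxA FN mul0mx addr0 mul0mx.
  (* (FBN)(FBN)^* = FBEBF = - FBNBF. *)
  apply: mulmx_trmxC_eq0; rewrite !trmxC_mul Nh Bh Fh.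
  rewrite !mulmxA -(mulmxA _ N N) -/E FBE 2!mulNmx.
  by rewrite FBNBF oppr0.
have FB : F *m B = 0.
  have -> : F *m B = F *m B *m F + F *m B *m N *m N.
    by rewrite -(mulmxA _ N N) -mulmxDr subrK mulmx1.
  by rewrite FBF FBN0 mul0mx addr0.
have BF : B *m F = 0.
  by rewrite -Bh -Fh -trmxC_mul FB trmx0 map_mx0.
have EB : E *m B = B.
  by apply/esym/eqP; rewrite -subr_eq0 -{1}[B]mul1mx -mulmxBl FB.
have BE : B *m E = B.
  by apply/esym/eqP; rewrite -subr_eq0 -{1}[B]mulmx1 -mulmxBr BF.
have {}NB : N *m B = B *m N.
  by move: NB; rewrite mulmxDl mulmxDr -/E EB BE => /addrI.
suff NB0 : N *m B = 0 by rewrite -EB -mulmxA NB0 mulmx0.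
apply: hermitian_eq0 => [|e v vNB er e0].
  by apply/hermP; rewrite trmxC_mul Nh Bh NB.
have NE : N *m E = N by rewrite mulmxA N3.
(* The row vN is killed by W, but W has the same row space as E, so W has a  *)
(* right inverse on the support of N; hence vN = 0.                          *)
pose W : 'M_n := N + (- e^-1) *: B.
have WE : W *m E = W by rewrite mulmxDl NE -scalemxAl BE.
have rkW : \rank W = \rank N by apply: rkN; rewrite rpredN rpredV.
have WsubE : (W <= E)%MS by rewrite -WE; exact: submxMl.
have /submxP[T ET] : (E <= W)%MS.
  by rewrite -(geq_leqif (mxrank_leqif_sup WsubE)) rkW mxrankM_maxr.
have vE : v = v *m E.
  have -> : v = e^-1 *: (v *m (N *m B)) by rewrite vNB scalerA mulVf // scale1r.
  by rewrite -scalemxAl -!mulmxA BE.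
have Wh : W^t* = W.
  rewrite linearD linearZ /= map_mxD map_mxZ Nh Bh.
  by rewrite /= rmorphN fmorphV /= (CrealP er).
have vNW : v *m N *m W = 0.
  rewrite mulmxDr -scalemxAr -!mulmxA vNB -/E -vE.
  by rewrite scalerA mulNr mulVf // scaleN1r subrr.
have EW : E = W *m T^t* by rewrite -Eh ET trmxC_mul Wh.
by rewrite vE {1}/E -{1}NE EW !mulmxA vNW !mul0mx.
Qed.

Lemma constant_rank_congruence_eq0 n (P N A B : 'M[C]_n) :
  P \in unitmx -> A = P^t* *m N *m P ->
  N \is hermsymmx -> N *m N *m N = N -> B \is hermsymmx ->
  (forall t, t \is Num.real -> \rank (A + t *: B)%R = \rank A) ->
  let B' := (invmx P)^t* *m B *m invmx P in
  (N *m N + N) *m B' = B' *m (N *m N + N) -> B = 0.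
Proof.
move=> Pu AE Nh N3 Bh rk B' comm.
have Ptu : P^t* \in unitmx by rewrite map_unitmx unitmx_tr.
have PtV : P^t* *m (invmx P)^t* = 1%:M.
  by rewrite -trmxC_mul mulVmx // trmx1 map_mx1.
have BE : B = P^t* *m B' *m P by rewrite /B' !mulmxA PtV mul1mx mulmxKV.
rewrite BE (@constant_rank_line_eq0 _ N B') ?mulmx0 ?mul0mx //.
  exact: hermitian_congruence.
move=> t tr; have := rk t tr.
rewrite AE {1}BE scalemxAl scalemxAr -mulmxDl -mulmxDr.
by rewrite !mxrank_mul_unit.
Qed.

End ConstantRankLines.

(** * Affine subspaces of hermitian matrices *)

Section AffineHermitian.
Variable R : realType.
Local Open Scope complex_scope.

(** The real and imaginary parts of the entries of the I x ~I block of
    Q^* B Q form an injective real-linear image of L. *)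
Lemma rect_block_dim n (Q : 'M[R[i]]_n) (I : {set 'I_n})
    (L : {vspace hermmx R n}) :
  (forall B, B \in L ->
     (forall i j, i \in I -> j \notin I -> (Q^t* *m B *m Q) i j = 0) ->
     B = 0) ->
  (\dim L <= 2 * #|I| * (n - #|I|))%N.
Proof.
move=> H; pose J := ~: I.
pose z (B : hermmx R n) (k : 'I_#|I|) (l : 'I_#|J|) :=
  (Q^t* *m B *m Q) (enum_val k) (enum_val l).
pose f (B : hermmx R n) : 'M[R]_(#|I|, #|J| + #|J|) :=
  row_mx (\matrix_(k, l) complex.Re (z B k l))
         (\matrix_(k, l) complex.Im (z B k l)).
have zl a A B k l : z (a *: A + B) k l = a%:C * z A k l + z B k l.
  by rewrite /z /= mulmxDr mulmxDl -scalemxAr -scalemxAl !mxE.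
have fl : linear f.
  move=> a A B; rewrite /f scale_row_mx add_row_mx.
  congr row_mx; apply/matrixP => k l; rewrite !mxE zl;
    case: (z A k l) => ? ?; case: (z B k l) => ? ? /=.
    by rewrite mul0r subr0.
  by rewrite mul0r addr0.
pose fL := GRing.isLinear.Build _ _ _ _ f fl.
pose g : {linear hermmx R n -> 'M[R]_(#|I|, #|J| + #|J|)} := HB.pack f fL.
have <- : \dim (linfun g @: L) = \dim L.
  apply: limg_dim_eq; apply/eqP; rewrite -subv0; apply/subvP => B.
  rewrite memv_cap memv_ker lfunE /= memv0 => /andP[BL /eqP fB].
  apply/eqP/H => // i j iI jI.
  have jJ : j \in J by rewrite inE.
  move/eqP: fB; rewrite row_mx_eq0 => /andP[/eqP/matrixP re0 /eqP/matrixP im0].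
  apply/eqP; rewrite eq_complex; apply/andP; split; apply/eqP.
    have := re0 (enum_rank_in iI i) (enum_rank_in jJ j).
    by rewrite [X in X = _]mxE [X in _ = X]mxE /z !enum_rankK_in.
  have := im0 (enum_rank_in iI i) (enum_rank_in jJ j).
  by rewrite [X in X = _]mxE [X in _ = X]mxE /z !enum_rankK_in.
have -> : (2 * #|I| * (n - #|I|) = \dim {: 'M[R]_(#|I|, #|J| + #|J|)})%N.
  have -> : (n - #|I|)%N = #|J| by rewrite [RHS]cardsCs finset.setCK card_ord.
  by rewrite dimvf dim_matrix; lia.
exact/dimvS/subvf.
Qed.

Lemma perm_eigenvalues n (A : 'M[R[i]]_n) : A \is hermsymmx ->
  perm_eq (eigenvalues A) [seq spectral_diag A 0 i | i <- enum 'I_n].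
Proof.
move=> Ah; apply: prod_XsubC_eq; rewrite -eigenvaluesE big_map big_enum /=.
have /orthomx_spectralP AE := hermitian_normalmx Ah.
rewrite {1}AE char_poly_conj ?spectral_unit //.
rewrite char_poly_trig ?diag_mx_is_trig //.
by apply: eq_bigr => i _; rewrite !mxE eqxx.
Qed.

Lemma count_eigenvalues n (A : 'M[R[i]]_n) (a : pred R[i]) :
  A \is hermsymmx ->
  count a (eigenvalues A) = #|[set i | a (spectral_diag A 0 i)]|.
Proof.
move=> Ah; rewrite (permP (perm_eigenvalues Ah)) count_map enumT.
rewrite cardE /enum_mem size_filter.
by apply: eq_count => i /=; rewrite inE.
Qed.

Lemma hermmx_hermitian n (M : hermmx R n) : (M : 'M_n) \is hermsymmx.
Proof. by case: M. Qed.

(** The splitting index set is that of the entries 1 of s, which makes the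
    lemma applicable both to the signs of M and to those of -M. *)
Lemma dim_constant_rank_signs (n r : nat) (M : hermmx R n)
    (L : {vspace hermmx R n}) (P : 'M[R[i]]_n) (s : 'rV[R[i]]_n) :
  P \in unitmx -> (M : 'M_n) = P^t* *m diag_mx s *m P ->
  (forall i, s 0 i \is Num.real) -> (forall i, s 0 i ^+ 3 = s 0 i) ->
  constant_rank r (affine_subspace M L) ->
  (\dim L <= 2 * #|[set i | s 0%R i == 1%R]|
             * (n - #|[set i | s 0%R i == 1%R]|))%N.
Proof.
move=> Pu ME sR s3 rk; set I := [set i | _].
have Mrank B : B \in L -> \rank (M + B : 'M_n)%R = r.
  by move=> BL; apply: rk; exists B.
apply: (@rect_block_dim _ (invmx P)) => B BL B0.
have B0t i j : i \notin I -> j \in I ->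
    ((invmx P)^t* *m B *m invmx P) i j = 0.
  move=> iI jI; apply/(can_inj conjCK); rewrite conjC0 -(B0 j i) //.
  have /hermP/matrixP/(_ j i) :=
    hermitian_congruence (invmx P) (hermmx_hermitian B).
  by rewrite 2!mxE.
apply/val_inj/(constant_rank_congruence_eq0 Pu ME) => //.
- apply/hermP; rewrite tr_diag_mx map_diag_mx; congr diag_mx.
  by apply/rowP => i; rewrite mxE; apply: CrealP.
- rewrite !mulmx_diag; congr diag_mx; apply/rowP => i.
  by rewrite !mxE -[RHS]s3 -!mulrA.
- exact: hermmx_hermitian.
- move=> t /RRe_real <-; set x := complex.Re t.
  have := Mrank (x *: B); rewrite memvZ // => /(_ isT) /= ->.
  by have := Mrank 0; rewrite mem0v addr0 => /(_ isT) /= ->.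
- move: ((invmx P)^t* *m B *m invmx P) B0 B0t => B' B0 B0t.
  rewrite mulmx_diag -raddfD; apply/matrixP => i j.
  rewrite mul_diag_mx mul_mx_diag !mxE.
  have s_off k : k \notin I -> s 0 k * s 0 k + s 0 k = 0.
    rewrite inE -subr_eq0 => sk; apply: (mulfI sk).
    rewrite mulr0 mulrBl mul1r mulrDr opprD addrA addrK.
    by apply/eqP; rewrite subr_eq0 -[X in _ == X]s3 !exprS expr0 mulr1.
  have [iI|iI] := boolP (i \in I); have [jI|jI] := boolP (j \in I).
  + by move: iI jI; rewrite !inE => /eqP -> /eqP ->; rewrite mulrC.
  + by rewrite B0 // mulr0 mul0r.
  + by rewrite B0t // mulr0 mul0r.
  + by rewrite !s_off // mulr0 mul0r.
Qed.

Lemma dim_constant_rank (n r : nat) (M : hermmx R n)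
    (L : {vspace hermmx R n}) :
  let p := count (fun z => 0 < z) (eigenvalues M) in
  let q := count (fun z => z < 0) (eigenvalues M) in
  constant_rank r (affine_subspace M L) ->
  (p + q)%N = r /\ (\dim L <= 2 * minn p q * (n - minn p q))%N.
Proof.
move=> p q rk; have Mh := hermmx_hermitian M.
have dR i := spectral_diag_real i Mh.
have [P Pu] := hermitian_inertia Mh.
set d := spectral_diag (M : 'M_n) in dR * => ME.
have pE : p = #|[set i | (map_mx Num.sg d) 0 i == 1]|.
  rewrite /p count_eigenvalues //; apply: eq_card => i; rewrite !inE mxE.
  case: (real_ltgt0P (dR i)) => [di|di|->].
  - by rewrite gtr0_sg ?eqxx.
  - by rewrite ltr0_sg // eqNr oner_eq0.
  - by rewrite sgr0 eq_sym oner_eq0.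
have qE : q = #|[set i | (- map_mx Num.sg d) 0 i == 1]|.
  rewrite /q count_eigenvalues //; apply: eq_card => i; rewrite !inE !mxE.
  case: (real_ltgt0P (dR i)) => [di|di|->].
  - by rewrite gtr0_sg // eqNr oner_eq0.
  - by rewrite ltr0_sg // opprK eqxx.
  - by rewrite sgr0 oppr0 eq_sym oner_eq0.
have sR i : Num.sg (d 0 i) \is Num.real.
  case: (real_ltgt0P (dR i)) => [di|di|->];
    by rewrite ?(gtr0_sg di) ?(ltr0_sg di) ?sgr0 ?rpredN ?real0 ?real1.
have s3 i : Num.sg (d 0 i) ^+ 3 = Num.sg (d 0 i).
  rewrite exprS sqr_sg.
  by case: eqVneq => [->|]; rewrite ?sgr0 ?mul0r ?mulr1.
split.
  rewrite /p /q !count_eigenvalues // -rank_inertia //; apply: rk.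
  by exists 0; rewrite ?addr0 //=; exact: mem0v.
have [_|_] := leqP p q.
  by rewrite pE; apply: (dim_constant_rank_signs Pu ME) rk => i; rewrite mxE.
have rkN : constant_rank r (affine_subspace (- M) L).
  move=> _ [B /= BL <-]; rewrite -mxrank_opp.
  have -> : - hermmx_val (- M + B) = hermmx_val (M - B).
    by rewrite /= opprD opprK.
  by apply: rk; exists (- B) => //=; rewrite memvN.
have MNE : (- M : hermmx R n) =
    P^t* *m diag_mx (- map_mx Num.sg d) *m P :> 'M_n.
  by rewrite raddfN mulmxN mulNmx -ME.
rewrite qE; apply: (dim_constant_rank_signs Pu MNE) rkN => i.
  by rewrite !mxE rpredN.
by rewrite !mxE exprNn s3 -signr_odd /= expr1 mulN1r.
Qed.

Lemma max_affine_dim_leq (K : fieldType) (V : vectType K)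
    (Q : set V -> Prop) m :
  (forall M L, Q (affine_subspace M L) -> (\dim L <= m)%N) ->
  (max_affine_dim Q <= m)%N.
Proof.
move=> H; apply/bigmax_leqP => d /asboolP[S [M [L [-> <-]]]]; exact: H.
Qed.

End AffineHermitian.

Theorem theorem12 (R : realType) :
  (forall n r : nat, (r <= n)%N ->
    (a_herm_rank R n r <= 2 * (r %/ 2) * (n - r %/ 2))%N) /\
  (forall n p q : nat, (p + q <= n)%N ->
    (a_herm_signature R n p q <= 2 * minn p q * (n - minn p q))%N).
Proof.
split=> [n r rn|n p q pqn]; apply: max_affine_dim_leq => M L.
  case/dim_constant_rank; set p := count _ _; set q := count _ _ => pqr.
  have mr : (minn p q <= r %/ 2)%N by rewrite leq_divRL //; lia.
  move=> /leq_trans; apply; rewrite -!mulnA leq_mul2l /=.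
  have : (r %/ 2 * 2 <= n)%N by rewrite (leq_trans _ rn) // leq_trunc_div.
  move: mr; set m := minn p q; set h := (r %/ 2)%N => mh hn; nia.
move=> sg; have rk : constant_rank (p + q) (affine_subspace M L).
  move=> A /sg[<- <-]; have Ah := hermmx_hermitian A.
  by rewrite rank_inertia // !count_eigenvalues.
have [<- <-] : has_signature (M : 'M_n) p q.
  by apply: sg; exists 0; rewrite ?addr0 //=; exact: mem0v.
by have [_] := dim_constant_rank rk.
Qed.
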